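(* Let $C=\begin{bmatrix} C_1 & N\\ N^\top & C_2\end{bmatrix}$ be a symmetric conference matrix of order $n$, partitioned so that $C_1$ and $C_2$ are square. Then: (i) $C_1$ has a symmetric spectrum if and only if $C_2$ has a symmetric spectrum. (ii) If $C_1$ and $C_2$ have symmetric spectrum then, except for eigenvalues equal to $\pm\sqrt{n-1}$, $C_1$ and $C_2$ have the same spectrum; that is, for every real $\lambda\notin\{\sqrt{n-1},-\sqrt{n-1}\}$ the multiplicity of $\lambda$ as an eigenvalue of $C_1$ equals its multiplicity as an eigenvalue of $C_2$ (multiplicity $0$ meaning that $\lambda$ is not an eigenvalue).
   Context: A conference matrix of order $n$ ($n\ge 2$) is an $n\times n$ matrix $C$ with diagonal entries $0$ and off-diagonal entries $\pm1$ satisfying $CC^\top=(n-1)I$. The spectrum of a matrix is the multiset of its eigenvalues, counted with multiplicity. A real symmetric matrix with spectrum $\Sigma$ has symmetric spectrum if $\Sigma=-\Sigma$ as multisets, i.e. for every $\lambda$ the multiplicities of $\lambda$ and $-\lambda$ as eigenvalues are equal. *)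

(* Defs.v *)
From HB Require Import structures.
From mathcomp Require Import all_boot all_order all_algebra.
From mathcomp Require Import reals.

Set Implicit Arguments.
Unset Strict Implicit.
Unset Printing Implicit Defensive.

Import Order.TTheory GRing.Theory Num.Theory.
Local Open Scope ring_scope.

Definition conference_matrix (R : realType) (n : nat) (C : 'M[R]_n) : Prop :=
  [/\ (2 <= n)%N,
      forall i, C i i = 0,
      forall i j, i != j -> C i j = 1 \/ C i j = -1 &
      C *m C^T = (n%:R - 1)%:M].

(* The multiset of eigenvalues of A in R, given by its multiplicity function:
   [spectrum A x] is the algebraic multiplicity of [x], and is 0 when [x] is not
   an eigenvalue.  Non-real eigenvalues are not recorded, so this is the full
   spectrum when A is symmetric, but not for an arbitrary A. *)
Definition spectrum (R : realType) (n : nat) (A : 'M[R]_n) (x : R) : nat :=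
  mup x (char_poly A).

Definition symmetric_spectrum (R : realType) (n : nat) (A : 'M[R]_n) : Prop :=
  forall x : R, spectrum A x = spectrum A (- x).

(* Main.v *)
Require Import Defs.
From HB Require Import structures.
From mathcomp Require Import all_boot all_order all_algebra.
From mathcomp Require Import reals.

(** Put c = n - 1, so that C^2 = c I, and write chi for characteristic
    polynomials.  Since (X - C)(X + C) = (X^2 - c) I, the matrix X + C is up to
    the factor X^2 - c the inverse of X - C, and Jacobi's identity for
    complementary minors of inverse matrices gives
<<
      chi_C(X) * chi_(-C1)(X) = (X^2 - c)^n1 * chi_C2(X)
>>
    ([char_poly_block_mul_opp]).  Comparing multiplicities of a root x turns
    this into
<<
      m_C(x) + m_C1(- x) = d(x) + m_C2(x),
>>
    where d(x), the multiplicity of x in (X^2 - c)^n1, is an even function.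
    The function m_C is even as well ([mup_char_poly_sqrt]): the eigenvalues of
    C are sqrt c and - sqrt c, and they add up to tr C = 0, so they occur
    equally often.  Hence m_C1 is even if and only if m_C2 is.  When x is neither
    sqrt c nor - sqrt c, both m_C(x) and d(x) vanish, so m_C1(- x) = m_C2(x),
    and the two spectra agree at x as soon as m_C1 is even.

    Working with polynomial identities and root multiplicities avoids
    diagonalizing C1 and C2. *)

Set Implicit Arguments.
Unset Strict Implicit.
Unset Printing Implicit Defensive.

Import Order.TTheory GRing.Theory Num.Theory.
Local Open Scope ring_scope.


Lemma char_poly_opp (R : nzRingType) n (A : 'M[R]_n) :
  char_poly (- A) = \det ('X%:M + map_mx (@polyC R) A).
Proof. by rewrite /char_poly /char_poly_mx map_mxN opprK. Qed.

Section SquareScalar.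

Variables (F : comNzRingType) (c : F).

Lemma char_poly_mx_mulD n (C : 'M[F]_n) : C *m C = c%:M ->
  char_poly_mx C *m ('X%:M + map_mx (@polyC F) C) = ('X^2 - c%:P)%:M.
Proof.
move=> CC; rewrite /char_poly_mx mulmxDr !mulmxBl -map_mxM CC map_scalar_mx /=.
rewrite -scalar_mxM -expr2 scalar_mxC addrA subrK.
by rewrite -raddfB.
Qed.

Lemma char_poly_mul_opp n (C : 'M[F]_n) : C *m C = c%:M ->
  char_poly C * char_poly (- C) = ('X^2 - c%:P) ^+ n.
Proof.
by move=> CC; rewrite char_poly_opp -det_mulmx char_poly_mx_mulD// det_scalar.
Qed.

(** Jacobi's complementary minor identity for X - C, whose inverse is X + C up to
    the scalar X^2 - c.  No inverse is taken: replacing the second block column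
    of X + C by that of the identity leaves a matrix of determinant
    det (X + A), and its product with X - C is block upper triangular. *)
Lemma char_poly_block_mul_opp n1 n2 (A : 'M[F]_n1) B D (E : 'M[F]_n2) :
    let C := block_mx A B D E in C *m C = c%:M ->
  char_poly C * char_poly (- A) = ('X^2 - c%:P) ^+ n1 * char_poly E.
Proof.
move=> C /char_poly_mx_mulD.
rewrite !char_poly_opp {1}/char_poly /char_poly_mx /C map_block_mx.
rewrite !(scalar_mx_block n1 n2) opp_block_mx !add_block_mx.
rewrite !add0r.
set P := block_mx _ _ _ (_ - _); set U := 'X%:M + map_mx _ A.
set V := map_mx _ D => /[dup] PQ.
rewrite mulmx_block => /eq_block_mx[PQul _ PQdl _].
have -> : \det U = \det (block_mx U 0 V (1%:M : 'M_n2)).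
  by rewrite det_lblock det1 mulr1.
rewrite -det_mulmx mulmx_block PQul PQdl !mulmx0 !mulmx1 !add0r.
by rewrite det_ublock det_scalar.
Qed.

End SquareScalar.

Section Multiplicity.

Variable F : fieldType.

(** Substituting - X sends the factor X + x to - (X - x), and the cofactor, which
    does not vanish at - x, to one that does not vanish at x. *)
Lemma mup_comp_oppX (p : {poly F}) x : p != 0 ->
  mup x (p \Po - 'X) = mup (- x) p.
Proof.
move=> p0; have [m [q]] := multiplicity_XsubC p (- x); rewrite p0 /= => qx ->.
have oppXE : ('X - (- x)%:P) \Po - 'X = - ('X - x%:P).
  by rewrite comp_polyB comp_polyX comp_polyC polyCN opprK opprB addrC.
rewrite comp_polyM rmorphXn /= oppXE exprNn mulrA.
rewrite !mupMr ?mup_XsubCX ?eqxx // rootE hornerM horner_comp horner_exp.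
by rewrite !hornerE mulf_neq0 ?signr_eq0.
Qed.

Lemma mup_char_poly_opp n (A : 'M[F]_n) x :
  mup x (char_poly (- A)) = mup (- x) (char_poly A).
Proof.
have char0 : char_poly A != 0 by rewrite monic_neq0 ?char_poly_monic.
rewrite -mup_comp_oppX // /char_poly -det_map_mx /char_poly_mx.
have -> : map_mx (comp_poly (- 'X)) ('X%:M - map_mx (@polyC F) A)
          = - ('X%:M - map_mx (@polyC F) (- A)).
  apply/matrixP => i j; rewrite !mxE comp_polyB comp_polyC polyCN.
  by rewrite raddfMn /= comp_polyX mulNrn opprB addrC.
rewrite -[in RHS]scaleN1r detZ mupMr //.
by rewrite rootE !(horner_exp, hornerE) signr_eq0.
Qed.

Lemma mup_Xsqr_subC_opp c n x :
  mup (- x) (('X^2 - c%:P) ^+ n) = mup x (('X^2 - c%:P) ^+ n :> {poly F}).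
Proof.
rewrite -mup_comp_oppX; last first.
  by rewrite expf_neq0 // monic_neq0 // monicXnsubC.
by rewrite rmorphXn /= comp_polyB comp_polyC rmorphXn /= comp_polyX sqrrN.
Qed.

Lemma mup_Xsqr_subC_eq0 c n x : x ^+ 2 != c ->
  mup x (('X^2 - c%:P) ^+ n :> {poly F}) = 0%N.
Proof.
by move=> xc; rewrite mupNroot // rootE horner_exp !hornerE expf_neq0 ?subr_eq0.
Qed.

End Multiplicity.

(** By [char_poly_mul_opp] the characteristic polynomial of C divides a power of
    (X - s)(X + s), so it splits with all roots in {s, - s}.  The sum of its
    roots is both tr C = 0 and s times the difference of the two
    multiplicities; as s is nonzero these multiplicities agree. *)
Lemma mup_char_poly_sqrt (F : numFieldType) n (C : 'M[F]_n) (s : F) :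
    s != 0 -> C *m C = (s ^+ 2)%:M -> \tr C = 0 -> forall x,
  mup (- x) (char_poly C) = mup x (char_poly C).
Proof.
move=> s0 CC trC; have CCE := char_poly_mul_opp CC.
have [r /allP rs Cr] : {r : seq F | all (mem [:: s; - s]) r &
    char_poly C = \prod_(x <- r) ('X - x%:P)}.
  have : char_poly C %| \prod_(x <- nseq n s ++ nseq n (- s)) ('X - x%:P).
    rewrite big_cat /= !big_nseq !iter_mulr_1 -exprMn polyCN opprK -subr_sqr.
    by rewrite -polyC_exp -CCE dvdp_mulr.
  move=> /dvdp_prod_XsubC[m eqm]; exists (mask m (nseq n s ++ nseq n (- s))).
    apply/allP => x /mem_mask; rewrite mem_cat !mem_nseq !inE.
    by case/orP=> /andP[_ ->]; rewrite ?orbT.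
  by apply/eqP; rewrite -eqp_monic ?char_poly_monic ?monic_prod_XsubC.
have sumr : \sum_(x <- r) x =
    (count_mem s r)%:R * s - (count_mem (- s) r)%:R * s.
  have sNs : s != - s by rewrite -subr_eq0 opprK -mulr2n mulrn_eq0.
  elim: r rs {Cr} => [|y r IH] rs; first by rewrite big_nil !mul0r subrr.
  rewrite big_cons /= IH => [|x xr]; last by rewrite rs // inE xr orbT.
  rewrite !natrD !mulrDl opprD addrACA; congr (_ + _).
  have := rs y (mem_head _ _); rewrite !inE => /orP[]/eqP->.
    by rewrite eqxx (negPf sNs) mul1r mul0r subr0.
  by rewrite eqxx eq_sym (negPf sNs) mul1r mul0r sub0r.
have {sumr}countE : count_mem s r = count_mem (- s) r.
  have rn : size r = n.
    by have := size_char_poly C; rewrite Cr size_prod_XsubC => -[].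
  have sum0 : \sum_(x <- r) x = 0.
    (* The trace is the coefficient of degree n - 1 only for positive n. *)
    case: (posnP n) => [n0|n_gt0].
      by move: rn; rewrite n0 => /size0nil->; rewrite big_nil.
    apply/eqP; rewrite -oppr_eq0 -coefPn_prod_XsubC ?rn -?lt0n // -Cr.
    by rewrite char_poly_trace // trC oppr0.
  apply/eqP; rewrite -(eqr_nat F) -(inj_eq (mulIf s0)) -subr_eq0 -sumr.
  exact/eqP.
move=> x; rewrite Cr !mu_prod_XsubC.
have [->|xs] := eqVneq x s; first by [].
have [->|xNs] := eqVneq x (- s); first by rewrite opprK.
rewrite !(count_memPn _) //; apply: contraT.
  by rewrite negbK => /rs; rewrite !inE (negPf xs) (negPf xNs).
by rewrite negbK => /rs; rewrite !inE eqr_oppLR eqr_opp (negPf xs) (negPf xNs).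
Qed.

Theorem corollary1 (R : realType) (n1 n2 : nat)
    (C1 : 'M[R]_n1) (N : 'M[R]_(n1, n2)) (C2 : 'M[R]_n2)
    (C_sym : (block_mx C1 N N^T C2)^T = block_mx C1 N N^T C2)
    (C_conf : conference_matrix (block_mx C1 N N^T C2)) :
  (symmetric_spectrum C1 <-> symmetric_spectrum C2) /\
  (symmetric_spectrum C1 -> symmetric_spectrum C2 ->
   forall x : R,
     x <> Num.sqrt ((n1 + n2)%:R - 1) ->
     x <> - Num.sqrt ((n1 + n2)%:R - 1) ->
     spectrum C1 x = spectrum C2 x).
Proof.
set n := (n1 + n2)%N in C_conf *; set C := block_mx C1 N N^T C2 in C_sym C_conf.
have [n_ge2 diag0 _ CCt] := C_conf.
set s := Num.sqrt (n%:R - 1 : R).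
have c_gt0 : 0 < n%:R - 1 :> R by rewrite subr_gt0 ltr1n.
have sE : s ^+ 2 = n%:R - 1 by rewrite sqr_sqrtr // ltW.
have s0 : s != 0 by rewrite gt_eqF // sqrtr_gt0.
have CC : C *m C = (s ^+ 2)%:M by rewrite sE -CCt C_sym.
have trC : \tr C = 0 by rewrite /mxtrace big1.
have specC := mup_char_poly_sqrt s0 CC trC.
have char0 m (A : 'M[R]_m) : char_poly A != 0.
  by rewrite monic_neq0 ?char_poly_monic.
pose d x := mup x (('X^2 - (s ^+ 2)%:P) ^+ n1 : {poly R}).
have dN x : d (- x) = d x by apply: mup_Xsqr_subC_opp.
have d0 m : ('X^2 - (s ^+ 2)%:P) ^+ m != 0 :> {poly R}.
  by rewrite expf_neq0 // monic_neq0 // monicXnsubC.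
have key x : (mup x (char_poly C) + spectrum C1 (- x) = d x + spectrum C2 x)%N.
  rewrite /spectrum -mup_char_poly_opp -!mupM //.
  by rewrite (char_poly_block_mul_opp CC).
(* The evenness of the multiplicities of C and of d puts the sign on C2. *)
have keyN x : (mup x (char_poly C) + spectrum C1 x = d x + spectrum C2 (- x))%N.
  by have := key (- x); rewrite specC dN opprK.
split.
  split=> symC x; apply/eqP.
    by rewrite -(eqn_add2l (d x)) -key -keyN (symC x).
  by rewrite -(eqn_add2l (mup x (char_poly C))) key keyN (symC x).
move=> symC1 symC2 x /eqP xs /eqP xNs.
have xc : x ^+ 2 != s ^+ 2 by rewrite eqf_sqr negb_or xs.
have Cx : mup x (char_poly C) = 0%N.
  apply/eqP; rewrite -leqn0 -(mup_Xsqr_subC_eq0 n xc) -(char_poly_mul_opp CC).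
  by rewrite mupM // leq_addr.
by rewrite symC1 -[LHS]add0n -{1}Cx key /d mup_Xsqr_subC_eq0.
Qed.
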